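(* Let $n \ge 3$ and let $S=\{0,a,b\}\subseteq \mathbb{Z}_n$ be a set of three distinct elements with $\gcd(a,b,n)=1$. Then \[p_{n}(S) = \begin{cases} 3 &\text{if } 3\mid n \text{ and } a \text{ and } b \text{ are in different nonzero congruence classes modulo } 3,\\ 1 &\text{if } n=7 \text{ and } \{0,a,b\} \text{ is equivalent to } \{0,1,3\} \text{ in } \mathbb{Z}_7,\\ 2 &\text{otherwise}. \end{cases}\]
   Context: $\mathbb{Z}_n$ is the additive group of integers modulo $n$; its elements are identified with the integers $0,1,\dots,n-1$ when speaking of gcds and congruence classes. For $S\subseteq \mathbb{Z}_n$ and $x\in\mathbb{Z}_n$, the set $x+S=\{x+s : s\in S\}$ is a translate of $S$. A coloring of the elements of $\mathbb{Z}_n$ with $k$ colors is $S$-polychromatic if every translate of $S$ contains an element of each of the $k$ colors. The polychromatic number $p_n(S)$ is the largest $k$ such that there is an $S$-polychromatic coloring of $\mathbb{Z}_n$ with $k$ colors. Two sets $S=\{a_1,\dots,a_t\}$ and $S'$ in $\mathbb{Z}_n$ are equivalent in $\mathbb{Z}_n$ if $S'=\{da_1+c,\dots,da_t+c\}$ for some $c,d\in\mathbb{Z}_n$ with $\gcd(d,n)=1$. *)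

(* Defs.v *)
From mathcomp Require Import all_boot all_order all_algebra.

Set Implicit Arguments.
Unset Strict Implicit.
Unset Printing Implicit Defensive.

Import GRing.Theory.
Local Open Scope ring_scope.

(* Everything below is over 'Z_n, which is the ring of integers modulo n only
   when n > 1.  The coercion 'Z_n >-> nat gives the representative in
   {0, ..., n - 1}. *)

Definition translate (n : nat) (x : 'Z_n) (S : {set 'Z_n}) : {set 'Z_n} :=
  [set x + s | s in S].

Definition polychromatic (n : nat) (S : {set 'Z_n}) (k : nat)
    (c : {ffun 'Z_n -> 'I_k}) : bool :=
  [forall x : 'Z_n, forall i : 'I_k, exists y in translate x S, c y == i].

Definition polychromatic_colorable (n : nat) (S : {set 'Z_n}) (k : nat) : bool :=
  [exists c : {ffun 'Z_n -> 'I_k}, polychromatic S c].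

(* The search is bounded by the number of elements of 'Z_n; by
   [polychromatic_numberP] the bound excludes no k. *)
Definition polychromatic_number (n : nat) (S : {set 'Z_n}) : nat :=
  \max_(k < #|'Z_n|.+1 | polychromatic_colorable S k) k.

Definition equivalent (n : nat) (S S' : {set 'Z_n}) : bool :=
  [exists c : 'Z_n, exists d : 'Z_n,
     coprime d n && (S' == [set d * x + c | x in S])].

Lemma polychromatic_colorable_leq (n : nat) (S : {set 'Z_n}) (k : nat) :
  polychromatic_colorable S k -> (k <= #|'Z_n|)%N.
Proof.
case/existsP=> c /forallP /(_ 0) /forallP cP.
have -> : k = #|c @: [set: 'Z_n]|.
  rewrite -[LHS]card_ord -cardsT; apply: eq_card => i.
  rewrite !inE; apply/esym/imsetP.
  by have /existsP[y /andP[_ /eqP <-]] := cP i; exists y.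
by rewrite (leq_trans (leq_imset_card _ _)) // cardsT.
Qed.

Lemma polychromatic_numberP (n : nat) (S : {set 'Z_n}) (k : nat) :
  S != set0 ->
  polychromatic_number S = k <->
  polychromatic_colorable S k /\
  (forall j : nat, polychromatic_colorable S j -> (j <= k)%N).
Proof.
case/set0Pn=> s sS.
have ub j : polychromatic_colorable S j -> (j <= polychromatic_number S)%N.
  move=> jP; have lt_j := polychromatic_colorable_leq jP.
  by rewrite -ltnS in lt_j; apply: (leq_bigmax_cond (Ordinal lt_j)).
have col1 : polychromatic_colorable S 1.
  apply/existsP; exists [ffun=> ord0]; apply/forallP=> x; apply/forallP=> i.
  apply/existsP; exists (x + s); rewrite imset_f //=.
  by rewrite (ord1 i) ffunE.
have colP : polychromatic_colorable S (polychromatic_number S).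
  have lt1 : (1 < #|'Z_n|.+1)%N by rewrite card_ord.
  rewrite /polychromatic_number (bigmax_eq_arg (Ordinal lt1)) //.
  by case: arg_maxnP.
split=> [<- // | [kP kmax]].
by apply/eqP; rewrite eqn_leq ub // kmax.
Qed.

(* Main.v *)
Require Import Defs.
From mathcomp Require Import all_boot all_order all_algebra.
From mathcomp Require Import zify ring.
Import GRing.Theory.
Local Open Scope ring_scope.

(** At most three colors can meet a three-element set, so everything rests on
deciding when three colors work, and when two do.

In a 3-coloring every translate of {0, a, b} is rainbow.  Comparing the
translates along multiples of a and b shows that a + b and 3a are periods of the
coloring.  Periods form an ideal, and 1 is a combination of a and b, so 3 is a
period as well ([colorable3_period]).  Hence the color depends on the residue
modulo 3 only, and 0, a, b have distinct residues ([colorable3_classes]).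
Conversely reduction modulo 3 is then a good coloring.

Two colors: for n even one of a, b is odd and parity works.  For n odd, place
Z_n on a circle and color x according to the half of the circle in which u * x
lies.  This is polychromatic as soon as the three points 0, ua, ub are not
contained in a half circle ([spread_colorable2]), so one looks for a suitable
multiplier u.

- If a is not invertible, let g = gcd(a, n) >= 3 and m = n / g >= 3.  The
  multiplier can be chosen with ua = (n - g) / 2, just under half a turn, and
  adding to u a multiple of m does not change ua.  As b is invertible modulo g, ub can be moved by
  any multiple of m, and there are at least m admissible positions for it
  ([nonunit_spread]).
- If a is invertible, scaling reduces to {0, 1, b}.  For b even,
  u = (n - 1) / 2 works.  For b odd, the reflection x |-> 1 - x exchanges b and
  n + 1 - b, so that 2b <= n + 1 can be assumed; then u = (n - r) / 2 works for
  every odd r with n < r (b - 1) and r b < 2 n.  Such an r exists except when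
  n = 7 and b = 3 ([odd_multiplier], [unit_spread]).

In Z_7 the translates of {0, 1, 3} are the lines of the Fano plane, which has no
2-coloring without a monochromatic line ([fano_not_colorable2]). *)

(** * Colorings and translates of a triple *)

Lemma val_addZ {n : nat} (hn : (1 < n)%N) (x y : 'Z_n) :
  (x + y)%R = ((x + y) %% n)%N :> nat.
Proof. exact: (congr1 (fun k => (x + y) %% k)%N (Zp_cast hn)). Qed.

Lemma ltn_Z {n : nat} (hn : (1 < n)%N) (x : 'Z_n) : (x < n)%N.
Proof. by have := ltn_ord x; rewrite [X in (_ < X)%N -> _](Zp_cast hn). Qed.

Lemma polychromatic3P {n : nat} (a b : 'Z_n) (k : nat)
    (c : {ffun 'Z_n -> 'I_k}) :
  reflect (forall x i, i \in [:: c x; c (x + a); c (x + b)])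
          (polychromatic [set 0; a; b] c).
Proof.
apply: (iffP forallP) => H x.
  move=> i; have /forallP/(_ i)/existsP[y /andP[/imsetP[s]]] := H x.
  rewrite !inE -orbA => /or3P[]/eqP-> -> /eqP<-.
  - by rewrite addr0 eqxx.
  - by rewrite eqxx orbT.
  - by rewrite eqxx !orbT.
apply/forallP=> i; apply/existsP; have := H x i; rewrite !inE.
case/or3P=> /eqP->; [exists x | exists (x + a) | exists (x + b)];
  rewrite eqxx andbT; apply/imsetP.
- by exists 0; rewrite ?addr0 // !inE eqxx.
- by exists a; rewrite // !inE eqxx orbT.
- by exists b; rewrite // !inE eqxx !orbT.
Qed.

Lemma colorable_leq3 {n : nat} (a b : 'Z_n) (k : nat) :
  polychromatic_colorable [set 0; a; b] k -> (k <= 3)%N.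
Proof.
case/existsP=> c /polychromatic3P/(_ 0) c0.
have := uniq_leq_size (enum_uniq 'I_k) (fun i _ => c0 i).
by rewrite size_enum_ord.
Qed.

Lemma colorable1 {n : nat} (a b : 'Z_n) :
  polychromatic_colorable [set 0; a; b] 1.
Proof.
apply/existsP; exists [ffun=> ord0]; apply/polychromatic3P=> x i.
by rewrite !ffunE (ord1 i) !inE.
Qed.

Lemma colorable2P {n : nat} (a b : 'Z_n) :
  (exists f : 'Z_n -> bool, forall x, ~~ ((f x == f (x + a)) && (f x == f (x + b))))
  <-> polychromatic_colorable [set 0; a; b] 2.
Proof.
split=> [[f fP] | /existsP[c /polychromatic3P cP]].
  apply/existsP; exists [ffun x => if f x then ord_max else ord0].
  apply/polychromatic3P=> x i; rewrite !ffunE !inE; have := fP x.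
  by case: (f x); case: (f (x + a)); case: (f (x + b));
     case: i => [[|[|i]]].
exists (fun x => c x == ord0) => x.
have := cP x ord0; have := cP x ord_max; rewrite !inE.
by case: (c x) (c (x + a)) (c (x + b)) =>
  [[|[|?]] ?] [[|[|?]] ?] [[|[|?]] ?].
Qed.

(** * Three colors *)

Lemma Bezout_Z {n : nat} (x y : nat) :
  exists i j : 'Z_n, (gcdn x y)%:R = i * x%:R + j * y%:R.
Proof.
case: (posnP x) => [-> | x_gt0].
  by exists 0, 1; rewrite gcd0n mul0r add0r mul1r.
have [k _ /dvdnP[q Eq]] := Bezoutl y x_gt0.
exists q%:R, (- k%:R).
by rewrite mulNr -!natrM -Eq natrD addrK.
Qed.

Lemma Zn_nat0 {n : nat} (hn : (1 < n)%N) : n%:R = 0 :> 'Z_n.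
Proof. by apply: val_inj; rewrite /= (val_Zp_nat hn) modnn. Qed.

Lemma Bezout_triple {n : nat} (hn : (1 < n)%N) {a b : 'Z_n}
    (hgcd : gcdn (gcdn a b) n = 1%N) :
  exists i j : 'Z_n, i * a + j * b = 1.
Proof.
have [k [l Ekl]] := @Bezout_Z n (gcdn a b) n.
have [i [j Eij]] := @Bezout_Z n a b.
exists (k * i), (k * j); rewrite hgcd Zn_nat0 // mulr0 addr0 in Ekl.
by apply: etrans (esym Ekl); rewrite Eij !natr_Zp mulrDr !mulrA.
Qed.

(** Every element of Z_n is an integer multiple of 1, so the group of periods of
a function is an ideal. *)
Lemma period_ideal {n : nat} {T : Type} {c : 'Z_n -> T} {v w : 'Z_n} (r s : 'Z_n) :
  (forall x, c (x + v) = c x) -> (forall x, c (x + w) = c x) ->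
  forall x, c (x + (r * v + s * w)) = c x.
Proof.
have mul z m : (forall x, c (x + z) = c x) -> forall x, c (x + m * z) = c x.
  move=> cz; rewrite -[m]natr_Zp mulr_natl.
  elim: (m : nat) => [|k IHk] x; first by rewrite addr0.
  by rewrite mulrSr addrA cz.
by move=> cv cw x; rewrite addrA !mul.
Qed.

(** The translates by x + a and by x + b exclude from c (x + a + b) every color
but c x, whence the period a + b.  The colors of x, x + a, x + 2a are then all
different, and the translate by x + 2a excludes the last two for c (x + 3a),
whence the period 3a.  The period 3 is a combination of these two since a and b
generate the unit ideal. *)
Lemma colorable3_period {n : nat} (hn : (1 < n)%N) {a b : 'Z_n}
    (hgcd : gcdn (gcdn a b) n = 1%N) (c : {ffun 'Z_n -> 'I_3}) :
  polychromatic [set 0; a; b] c ->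
  (forall x, uniq [:: c x; c (x + a); c (x + b)]) /\
  (forall x, c (x + 3%:R) = c x).
Proof.
move=> /polychromatic3P cP.
have cU x : uniq [:: c x; c (x + a); c (x + b)].
  apply: (leq_size_uniq (enum_uniq 'I_3)); last by rewrite size_enum_ord.
  by move=> i _; apply: cP.
split=> //.
have cD x : c (x + (a + b)) = c x.
  have := cP x (c (x + (a + b))); rewrite !inE => /or3P[]/eqP // E.
  - by have := cU (x + a); rewrite /= !inE -!addrA E eqxx /= orbT.
  - by have := cU (x + b); rewrite /= !inE -!addrA [b + a]addrC E eqxx.
have c3 x : c (x + 3%:R * a) = c x.
  have Ex y : y + a + b = y + (a + b) by rewrite addrA.
  have := cP (x + a) (c (x + 3%:R * a)).
  have := cU (x + a + a).
  have -> : x + a + a + a = x + 3%:R * a by ring.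
  have -> : x + a + a + b = x + a + (a + b) by ring.
  rewrite Ex !cD /= !inE => /andP[/norP[n1 _] /andP[n2 _]] /or3P[]/eqP E //.
  - by rewrite E eqxx in n2.
  - by rewrite E eqxx in n1.
have [i [j Eij]] := Bezout_triple hn hgcd.
have -> : 3%:R = (i - j) * (3%:R * a) + (3%:R * j) * (a + b).
  by rewrite -[LHS]mulr1 -Eij; ring.
exact: period_ideal.
Qed.

(** By the period 3, congruent elements have the same color, while 0, a, b have
three different ones.  If 3 did not divide n, it would be invertible, and the
coloring constant. *)
Lemma colorable3_classes {n : nat} (hn : (1 < n)%N) {a b : 'Z_n}
    (hgcd : gcdn (gcdn a b) n = 1%N) :
  polychromatic_colorable [set 0; a; b] 3 ->
  [&& (3 %| n)%N, (a %% 3 != 0)%N, (b %% 3 != 0)%N & (a %% 3 != b %% 3)%N].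
Proof.
case/existsP=> c /(colorable3_period hn hgcd)[cU c3].
have c3M x v : c (x + v * 3%:R) = c x.
  have := period_ideal v 0 c3 c3 x.
  by rewrite mul0r addr0.
have := cU 0; rewrite !add0r /= !inE => /and3P[/norP[c0a c0b] cab _].
have cmod (v w : 'Z_n) : (v %% 3 = w %% 3)%N -> c v = c w.
  move=> E; rewrite -(c3M w ((v %/ 3)%:R - (w %/ 3)%:R)); congr (c _).
  have dec (z : 'Z_n) : z = (z %/ 3)%:R * 3%:R + (z %% 3)%:R.
    by rewrite -natrM -natrD -divn_eq natr_Zp.
  by apply: (etrans (dec v)); rewrite E [X in _ = X + _]dec; ring.
have ne (v w : 'Z_n) : c v != c w -> (v %% 3 != w %% 3)%N.
  by apply: contra => /eqP/cmod/eqP.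
rewrite (ne _ _ cab) eq_sym (ne 0) // eq_sym (ne 0) // !andbT.
apply: contraR c0a => n3.
have u3 : (3%:R : 'Z_n) \is a GRing.unit.
  by rewrite unitZpE // coprime_sym prime_coprime.
by rewrite -(divrK u3 a) -[X in _ == c X]add0r c3M.
Qed.

Lemma colorable3 {n : nat} (hn : (1 < n)%N) (a b : 'Z_n) :
  [&& (3 %| n)%N, (a %% 3 != 0)%N, (b %% 3 != 0)%N & (a %% 3 != b %% 3)%N] ->
  polychromatic_colorable [set 0; a; b] 3.
Proof.
case/and4P=> n3 a0 b0 ab; apply/existsP.
exists [ffun x : 'Z_n => inord (x %% 3)].
apply/polychromatic3P=> x i; rewrite !ffunE !inE.
have inordE k : (i == inord (k %% 3)) = (i == k %% 3 :> nat)%N.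
  by rewrite -val_eqE /= inordK // ltn_mod.
rewrite !inordE !val_addZ // !modn_dvdm //.
by have := ltn_ord i; lia.
Qed.

(** * Two colors from a half circle *)

(** The triple 0, s, t goes around the circle: s lies in the first half, and t
lies strictly between the antipodes of 0 and of s, so that 0, s, t are in no
common half circle. *)
Definition spread {n : nat} (s t : 'Z_n) : bool :=
  [&& (2 * s < n)%N, (n < 2 * t)%N & (2 * t < 2 * s + n)%N].

(** A monochromatic translate of {0, a, b} would put u * x, u * x + u * a and
u * x + u * b in a common half circle. *)
Lemma spread_colorable2 {n : nat} (hn : (1 < n)%N) (a b u : 'Z_n) :
  spread (u * a) (u * b) -> polychromatic_colorable [set 0; a; b] 2.
Proof.
case/and3P=> h1 h2 h3; apply/colorable2P.
exists (fun x : 'Z_n => 2 * (u * x)%R < n)%N => x.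
rewrite !mulrDr !val_addZ //.
have := ltn_Z hn (u * x); have := ltn_Z hn (u * b).
have mod1 k : (k < 2 * n)%N -> (k %% n = if k < n then k else k - n)%N.
  move=> kn; case: ltnP => h; first by rewrite modn_small.
  by rewrite -{1}(subnK h) modnDr modn_small //; lia.
move=> hb hx; rewrite !mod1; try lia.
move: h1 h2 h3 hb hx.
move: (nat_of_ord (u * x)) (nat_of_ord (u * a)) (nat_of_ord (u * b)) => y s t.
by move=> *; do 2?[case: ifPn => ?]; lia.
Qed.

(** The number t is the representative of u * b; the first hypothesis is the
congruence of the two modulo n, shifted by n to avoid subtraction. *)
Lemma spread_natr {n : nat} (hn : (1 < n)%N) (b : 'Z_n) (u t e : nat) :
  (u * b + n = t + n * e)%N ->
  (2 * u < n)%N -> (n < 2 * t)%N -> (2 * t < 2 * u + n)%N ->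
  @spread n u%:R (u%:R * b).
Proof.
move=> E h1 h2 h3.
have -> : u%:R * b = t%:R.
  have := congr1 (fun k => k%:R : 'Z_n) E.
  by rewrite !natrD !natrM natr_Zp Zn_nat0 // mul0r !addr0.
by rewrite /spread !val_Zp_nat // !modn_small; lia.
Qed.

(** The reflection x |-> s - x exchanges 0 and s, and maps the arc between their
antipodes to itself. *)
Lemma spread_reflect {n : nat} (hn : (1 < n)%N) (s t : 'Z_n) :
  spread s t -> spread s (s - t).
Proof.
rewrite /spread => /and3P[h1 h2 h3].
have ht := ltn_Z hn t.
have -> : s - t = (s + n - t)%N%:R.
  by rewrite natrB ?natrD ?Zn_nat0 ?addr0 ?natr_Zp //; lia.
by rewrite !val_Zp_nat // !modn_small; lia.
Qed.

(** The least odd r with n < r (b - 1) works: by minimality (r - 2) (b - 1) < n,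
and this bound on n gives r b < 2 n once r and b are at least 5.  The cases
r = 3 and b = 3 are checked separately; n = 7, b = 3 is the one failure, where
r = 5 and 5 * 3 > 2 * 7. *)
Lemma odd_multiplier {n b : nat} (on : odd n) (ob : odd b) :
  (3 <= b)%N -> (2 * b <= n.+1)%N -> (n, b) != (7, 3)%N ->
  exists r : nat, [&& odd r, (n < r * b.-1)%N & (r * b < 2 * n)%N].
Proof.
move=> b3 bn nb.
have ex : exists r, odd r && (n < r * b.-1)%N.
  by exists n; rewrite on /=; nia.
have [r /andP[or rP] rmin] := ex_minnP ex.
exists r; rewrite or rP /=.
have r3 : (3 <= r)%N by case: r or rP {rmin} => [|[|[|r]]] //; nia.
have or2 : odd (r - 2) by lia.
have {}rmin : ((r - 2) * b.-1 < n)%N.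
  have : ~~ (n < (r - 2) * b.-1)%N.
    apply/negP=> h; have := rmin (r - 2)%N; rewrite h andbT => /(_ or2).
    by lia.
  rewrite -leqNgt leq_eqVlt => /orP[/eqP E | //].
  (* Equality is impossible: n is odd and b - 1 is even. *)
  by move: on; rewrite -E oddM; case: (b) ob b3 => //= b' /negbTE->; rewrite andbF.
have [E|r5] : r = 3%N \/ (5 <= r)%N by move: or; lia.
  by rewrite E in rP rmin *; move: nb; rewrite xpair_eqE; lia.
have [E|b5] : b = 3%N \/ (5 <= b)%N by move: ob; lia.
  by rewrite E in rP rmin nb *; move: nb; rewrite xpair_eqE; lia.
clear -rmin r5 b5; rewrite -(subnK r5) -(subnK b5) in rmin *.
by move: (r - 5)%N (b - 5)%N rmin => r' b'; rewrite addnS /=; nia.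
Qed.

(** For n even, parity is well defined on Z_n, and one of a, b is odd. *)
Lemma even_colorable2 {n : nat} (hn : (1 < n)%N) (a b : 'Z_n) :
  ~~ odd n -> gcdn (gcdn a b) n = 1%N ->
  polychromatic_colorable [set 0; a; b] 2.
Proof.
move=> en hgcd; apply/colorable2P; exists (fun x : 'Z_n => odd x) => x.
have oddD (v : 'Z_n) : odd (x + v)%R = odd x (+) odd v.
  by rewrite val_addZ // -oddD [in RHS](divn_eq (x + v) n) oddD oddM (negbTE en)
    andbF.
rewrite !oddD; have : odd a || odd b.
  apply: contraT; rewrite negb_or -!dvdn2 => /andP[a2 b2].
  have : (2 %| gcdn (gcdn a b) n)%N by rewrite !dvdn_gcd a2 b2 dvdn2.
  by rewrite hgcd.
by case: (odd x); case: (odd a); case: (odd b).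
Qed.

(** Write n = m g with g = gcd(a, n).  A Bezout coefficient k with k a = g gives
the multiplier k (m - 1) / 2, which sends a to (n - g) / 2.  Subtracting from it
a multiple of m i, where i inverts b modulo g, leaves the image of a unchanged
and shifts that of b by multiples of m.  The target of b is the window of m
integers starting at (n + 1) / 2; it ends below (n - g) / 2 + n / 2 because
2 m + g <= m g. *)
Lemma nonunit_spread {n : nat} (hn : (1 < n)%N) (a b : 'Z_n) :
  odd n -> a != 0 -> ~~ coprime a n -> gcdn (gcdn a b) n = 1%N ->
  exists u : 'Z_n, spread (u * a) (u * b).
Proof.
move=> on a0 an hgcd; pose g := gcdn a n.
have [m En] := dvdnP (dvdn_gcdr a n); rewrite -/g in En.
have [a' Ea] := dvdnP (dvdn_gcdl a n); rewrite -/g in Ea.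
have [om og] : odd m /\ odd g by apply/andP; rewrite -oddM -En.
have g3 : (3 <= g)%N.
  by move: an og; rewrite /coprime -/g; case: (g) => [|[|[|]]].
have m3 : (3 <= m)%N.
  have m1 : m != 1%N.
    apply: contra a0 => /eqP m1; rewrite -val_eqE /=.
    have ag : (a < g)%N by rewrite -[g]mul1n -{1}m1 -En ltn_Z.
    by apply/eqP; move: ag; rewrite [nat_of_ord a]Ea; case: (a') => // k; nia.
  by move: m1 om; case: (m) => [|[|[|]]].
have n0 : m%:R * g%:R = 0 :> 'Z_n by rewrite -natrM -En Zn_nat0.
have ma0 : m%:R * a = 0 by rewrite -[a]natr_Zp Ea natrM mulrCA n0 mulr0.
have [k [l Eg]] := @Bezout_Z n a n.
rewrite -/g natr_Zp Zn_nat0 // mulr0 addr0 in Eg.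
have [i [j E1]] := @Bezout_Z n b g.
have gb1 : gcdn b g = 1%N by rewrite /g gcdnA [gcdn b a]gcdnC.
rewrite gb1 natr_Zp in E1.
(* w is the first point of the window, and r < m is the offset at which the
   class of y modulo m meets it. *)
pose y := k * (m./2)%:R * b; pose w := n./2.+1.
pose q := ((y + n - w) %/ m)%N; pose r := ((y + n - w) %% m)%N.
exists (k * (m./2)%:R - q%:R * m%:R * i).
have -> : (k * (m./2)%:R - q%:R * m%:R * i) * a = (m./2 * g)%N%:R.
  rewrite mulrBl -mulrA [_ * i]mulrC -!mulrA ma0 !mulr0 subr0.
  by rewrite natrM Eg; ring.
have -> : (k * (m./2)%:R - q%:R * m%:R * i) * b = (w + r)%N%:R.
  have Eq : (w + r + q * m = y + n)%N.
    by rewrite /r addnAC -addnA -divn_eq subnKC //; rewrite /w; lia.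
  have Ey : y = (w + r)%N%:R + q%:R * m%:R.
    by rewrite -natrM -natrD Eq natrD Zn_nat0 // addr0 natr_Zp.
  have Emi : m%:R * i * b = m%:R.
    rewrite -[RHS]mulr1 [X in _ = _ * X]E1 mulrDr [X in _ + X]mulrCA n0 mulr0 addr0.
    by rewrite mulrA.
  rewrite mulrBl -/y Ey -[X in _ - X]mulrA -[X in _ - X]mulrA [m%:R * _]mulrA Emi.
  by rewrite addrK.
have rm : (r < m)%N by rewrite ltn_mod; lia.
have m2 : (2 * m./2 + 1 = m)%N by lia.
have key : (2 * m + g <= m * g)%N by move: (g) g3 => h h3; clear -m3 h3; nia.
have h2 : (2 * (m./2 * g) + g = n)%N by rewrite En -[in RHS]m2 mulnDl mul1n mulnA.
rewrite /spread !val_Zp_nat // !modn_small /w; lia.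
Qed.

(** With u = (n - r) / 2 one has 2 u b = n b - r b, where n b is congruent to 3 n
modulo 2 n since b is odd; so u * b is represented by (3 n - r b) / 2.  The two
inequalities on r say that this point lies between the antipodes of 0 and of
u. *)
Lemma odd_spread {n : nat} (hn : (1 < n)%N) (b : 'Z_n) :
  odd n -> odd b -> (3 <= b)%N -> (2 * b <= n.+1)%N ->
  (n, nat_of_ord b) != (7, 3)%N -> exists u : 'Z_n, spread u (u * b).
Proof.
move=> on ob b3 bn nb; have [r /and3P[or rn rb]] := odd_multiplier on ob b3 bn nb.
exists ((n - r)./2)%:R.
have rbE : (r * b.-1 + r = r * b)%N by rewrite addnC -mulnS prednK //; lia.
have orb : odd (r * b)%N by rewrite oddM or ob.
apply: (spread_natr hn b _ (3 * n - r * b)./2 b./2).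
- have rn' : (r <= n)%N by clear -rb b3; nia.
  have Eu : (2 * ((n - r)./2 * b) + r * b = n * b)%N.
    by rewrite mulnA -mulnDl; congr (_ * _)%N; lia.
  have En : (2 * (n * b./2) + n = n * b)%N.
    by rewrite mulnCA -mulnSr; congr (_ * _)%N; lia.
  by lia.
- by lia.
- by lia.
- by lia.
Qed.

(** For b = 2e, the multiplier (n - 1) / 2 sends b to n - e.  The odd b above
(n + 1) / 2 are reduced to the others by the reflection b |-> 1 - b; it turns
the exception b = 3 for n = 7 into b = 5. *)
Lemma unit_spread {n : nat} (hn : (1 < n)%N) (b : 'Z_n) :
  odd n -> b != 0 -> b != 1 -> (n == 7) && ((b == 3 :> nat) || (b == 5 :> nat)) = false ->
  exists u : 'Z_n, spread u (u * b).
Proof.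
move=> on b0 b1 nb; have bn := ltn_Z hn b.
have {b0 b1} b2 : (2 <= b)%N.
  by move: (natr_Zp b) b0 b1; case: (nat_of_ord b) => [|[|]] // <-;
    rewrite ?mulr0n ?mulr1n eqxx.
have [ob | eb] := boolP (odd b); last first.
  exists (n./2)%:R.
  by apply: (spread_natr hn b _ (n - b./2) b./2); nia.
have [le | gt] := leqP (2 * b) n.+1.
  by apply: odd_spread => //; [lia | move: nb; rewrite xpair_eqE; lia].
have n1 : n.+1%:R = 1 :> 'Z_n by rewrite -[n.+1]add1n natrD Zn_nat0 // addr0.
have E : 1 - b = (n.+1 - b)%N%:R.
  by rewrite natrB ?natr_Zp 1?ltnW // ?n1 // ltnW.
have Ev : nat_of_ord (1 - b) = (n.+1 - b)%N.
  by rewrite E val_Zp_nat // modn_small //; lia.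
have [||||u] := odd_spread hn (1 - b) on; rewrite ?Ev; try lia.
  by move: nb; rewrite xpair_eqE; lia.
by move=> /(spread_reflect hn) us; exists u; rewrite mulrBr mulr1 subKr in us.
Qed.

(** * The Fano plane *)

(** An affine bijection carries translates to translates, so a coloring is
transported by its inverse. *)
Lemma equivalent_colorable {n : nat} (hn : (1 < n)%N) (S S' : {set 'Z_n}) (k : nat) :
  equivalent S S' -> polychromatic_colorable S k -> polychromatic_colorable S' k.
Proof.
case/existsP=> e /existsP[d /andP[dn /eqP->]] /existsP[c /forallP cP].
have ud : d \is a GRing.unit by rewrite -[d]natr_Zp unitZpE // coprime_sym.
apply/existsP; exists [ffun y => c (d^-1 * y)].
apply/forallP=> x; apply/forallP=> i.
have /forallP/(_ i)/existsP[_ /andP[/imsetP[s sS ->] cs]] := cP (d^-1 * (x + e)).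
apply/existsP; exists (x + (d * s + e)); rewrite ffunE; apply/andP; split.
  by apply: imset_f; apply: (imset_f (fun y => d * y + e)).
by rewrite addrCA mulrDr mulKr // [s + _]addrC.
Qed.

Lemma fano_not_colorable2 :
  ~~ polychromatic_colorable [set 0; 1; 3%:R : 'Z_7] 2.
Proof.
apply/negP=> /colorable2P[f fP].
pose F k := f (k%:R).
have {}fP k : ~~ ((F k == F (k + 1)%N) && (F k == F (k + 3)%N)).
  by rewrite /F !natrD; apply: fP.
have F7 k : F (k + 7)%N = F k by rewrite /F natrD Zn_nat0 // addr0.
have := (fP 0, fP 1, fP 2, fP 3, fP 4, fP 5, fP 6)%N.
have := (F7 0, F7 1, F7 2)%N.
(* By periodicity only seven truth values remain: a finite check. *)
rewrite !add0n !add1n /= => -[[-> ->] ->].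
case: (F 0%N); case: (F 1%N); case: (F 2%N); case: (F 3%N); case: (F 4%N);
  case: (F 5%N); case: (F 6%N) => //=; by case; do 6?case.
Qed.

(** After division by a, the triple is {0, 1, 3} or {0, 1, 5}, and x |-> 1 - x
maps the latter to the former. *)
Lemma fano_equivalent (a b : 'Z_7) :
  a \is a GRing.unit -> (a^-1 * b == 3 :> nat) || (a^-1 * b == 5 :> nat) ->
  equivalent [set 0; a; b] [set 0; 1; 3%:R].
Proof.
move=> ua h.
have cop (d : 'Z_7) : d \is a GRing.unit -> coprime d 7.
  by rewrite -{1}[d]natr_Zp unitZpE // coprime_sym.
apply/existsP; case/orP: h => /eqP h.
  have {}h : a^-1 * b = 3%:R by apply: val_inj.
  exists 0; apply/existsP; exists a^-1; rewrite cop ?unitrV //=.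
  by rewrite !imsetU !imset_set1 !addr0 mulr0 mulVr // h.
have {}h : a^-1 * b = 5%:R by apply: val_inj.
exists 1; apply/existsP; exists (- a^-1); rewrite cop ?unitrN ?unitrV //=.
rewrite !imsetU !imset_set1 mulr0 add0r !mulNr mulVr // h addNr.
by rewrite [[set 1; 0]]setUC; apply/eqP; congr (_ :|: [set _]); apply: val_inj.
Qed.

Lemma colorable2 {n : nat} (hn : (3 <= n)%N) (a b : 'Z_n) :
  uniq [:: 0; a; b] -> gcdn (gcdn a b) n = 1%N ->
  ~~ ((n == 7) && equivalent [set 0; a; b] [set 0; 1; 3%:R]) ->
  polychromatic_colorable [set 0; a; b] 2.
Proof.
have hn1 : (1 < n)%N by apply: ltnW.
rewrite /= !inE negb_or ![0 == _]eq_sym => /and3P[/andP[a0 b0] ab _] hgcd nf.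
have [on | en] := boolP (odd n); last exact: even_colorable2.
have [ua | nua] := boolP (coprime a n); last first.
  by have [u /(spread_colorable2 hn1)] := nonunit_spread hn1 a b on a0 nua hgcd.
have {}ua : a \is a GRing.unit by rewrite -[a]natr_Zp unitZpE // coprime_sym.
have [|||u] := unit_spread hn1 (a^-1 * b) on.
- by rewrite -(mulr0 a^-1) (inj_eq (mulrI _)) ?unitrV.
- by rewrite -(mulVr ua) (inj_eq (mulrI _)) ?unitrV // eq_sym.
- apply: contraNF nf => /andP[n7 h]; rewrite n7 /=.
  by move: (eqP n7) => n7'; subst n; apply: fano_equivalent.
rewrite -{1}[u](divrK ua) mulrA => us.
exact: (spread_colorable2 hn1 a b (u / a)).
Qed.

Theorem theorem2p6 (n : nat) (hn : (3 <= n)%N) (a b : 'Z_n)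
    (hdistinct : uniq [:: 0; a; b])
    (hgcd : gcdn (gcdn a b) n = 1%N) :
  polychromatic_number [set 0; a; b] =
    if [&& (3 %| n)%N, (a %% 3 != 0)%N, (b %% 3 != 0)%N & (a %% 3 != b %% 3)%N]
    then 3%N
    else if (n == 7)%N && equivalent [set 0; a; b] [set 0; 1; 3%:R]
    then 1%N
    else 2%N.
Proof.
have hn1 : (1 < n)%N by apply: ltnW.
apply/polychromatic_numberP.
  by apply/set0Pn; exists 0; rewrite !inE eqxx.
case: ifPn => [/(colorable3 hn1) c3 | n3].
  by split=> // j; apply: colorable_leq3.
have le2 j : polychromatic_colorable [set 0; a; b] j -> (j <= 2)%N.
  move=> cj; have := colorable_leq3 _ _ _ cj.
  rewrite leq_eqVlt => /orP[/eqP Ej | //].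
  by rewrite Ej in cj; rewrite (colorable3_classes hn1 hgcd cj) in n3.
case: ifPn => [/andP[/eqP n7 eq7] | nf]; last first.
  by split=> //; apply: colorable2.
split=> [|j cj]; first exact: colorable1.
have := le2 j cj; rewrite leq_eqVlt => /orP[/eqP Ej | //].
subst n j; have := equivalent_colorable hn1 _ _ _ eq7 cj.
by rewrite (negbTE fano_not_colorable2).
Qed.
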